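(* Assume $T$ is locally finite, let $p\in(1,\infty]$ and let $f$ be a harmonic function on $T$. Then there exists $g\in L^p(\partial T,\nu)$ with $f=\mathcal Pg$ on $T$ if and only if $f\in H^p$.
   Context: Let $T$ be a tree, identified with its vertex set, with graph distance $d$; $x\sim y$ means $d(x,y)=1$. Let $\Omega$ be the boundary (space of ends) of $T$; fix $\omega_*\in\Omega$ and set $\partial T=\Omega\setminus\{\omega_*\}$. For $\omega\in\partial T$, $(\omega,\omega_* )$ denotes the doubly infinite geodesic joining $\omega$ and $\omega_*$; for $x\in T$ write $\omega\le x$ if $x\in(\omega,\omega_* )$. Fix $o\in T$ and let $(x_j)_{j\ge0}$ enumerate the geodesic ray from $o$ to $\omega_*$ with $x_0=o$, $x_j\sim x_{j+1}$; the level of $x\in T$ is $\ell(x)=\lim_{j\to\infty}(j-d(x,x_j))$. The successors of $x$ are $s(x)=\{y\sim x:\ell(y)=\ell(x)-1\}$. For $x\in T$ let $\partial T_x=\{\omega\in\partial T:\omega\le x\}$. $\nu$ is a positive Borel measure on $\partial T$ with $0<\nu(\partial T_x)<\infty$ for all $x$, and $m_\nu(x)=\nu(\partial T_x)$. The Laplacian is $\Delta f(x)=f(x)-\sum_{y\in s(x)}f(y)\frac{m_\nu(y)}{m_\nu(x)}$; $f$ is harmonic if $\Delta f\equiv0$ on $T$. The Poisson integral is $\mathcal Pg(x)=\int_{\partial T}P(x,\omega)g(\omega)\,d\nu(\omega)=\frac{1}{m_\nu(x)}\int_{\partial T_x}g\,d\nu$, with $P(x,\omega)=\chi_{\partial T_x}(\omega)/m_\nu(x)$.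 The Hardy space $H^p$ consists of harmonic $f$ with $\|f\|_{H^p}^p=\sup_{k\in\mathbb Z}\sum_{\ell(x)=k}|f(x)|^pm_\nu(x)<\infty$ if $1\le p<\infty$, and $\|f\|_{H^\infty}=\sup_{x\in T}|f(x)|<\infty$ if $p=\infty$. *)

(* Defs.v *)
From HB Require Import structures.
From mathcomp Require Import all_boot all_order all_algebra.
From mathcomp Require Import all_classical all_reals all_analysis.
Set Implicit Arguments. Unset Strict Implicit. Unset Printing Implicit Defensive.
Import Order.TTheory GRing.Theory Num.Theory.
Local Open Scope classical_set_scope.
Local Open Scope ring_scope.

(* A tree T (vertex type V) together with a distinguished end omega_star and a
   base vertex o is encoded by the map par : V -> V sending x to its unique
   neighbour on the ray from x to omega_star, and the level function lev.
   (lev is the paper's level l(x) = lim_j (j - d(x,x_j)), x_j = par^j o.) *)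
Section Tree.
Variables (V : choiceType) (par : V -> V) (lev : V -> int) (o : V).

(* The structure axioms: levels increase by one towards omega_star, lev o = 0,
   and the graph is connected (any two vertices have a common ancestor). *)
Definition Ttree_with_end : Prop :=
  [/\ (forall x, lev (par x) = lev x + 1),
      lev o = 0
    & (forall x y, exists a b : nat, iter a par x = iter b par y)].

Definition Tadj (x y : V) : Prop := par x = y \/ par y = x.

Definition Tlocally_finite : Prop := forall x, finite_set [set y | Tadj x y].

Definition Tsucc (x : V) : set V := [set y | Tadj y x /\ lev y = lev x - 1].

(* g : int -> V enumerates (by level) the vertices of a doubly infinite
   geodesic (omega, omega_star) with omega <> omega_star, i.e. an element of dT. *)
Definition Tis_end (g : int -> V) : Prop :=
  forall k : int, par (g k) = g (k + 1) /\ lev (g k) = k.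
End Tree.

Section Boundary.
Variables (V : choiceType) (d : measure_display) (Omega : measurableType d).
Variables (R : realType) (e : Omega -> (int -> V)).

Definition Tbdry_cyl (x : V) : set Omega := [set w | exists k, e w k = x].

(* Omega, via e, is the boundary dT with its Borel sigma-algebra, which is the
   sigma-algebra generated by the (clopen, basic) sets dT_x. *)
Definition Tboundary_model (par : V -> V) (lev : V -> int) : Prop :=
  [/\ (forall w, Tis_end par lev (e w)),
      injective e,
      (forall g, Tis_end par lev g -> exists w, e w = g)
    & (@measurable d Omega) = <<s range Tbdry_cyl >>].

Variable nu : {measure set Omega -> \bar R}.

Definition Tm_nu (x : V) : R := fine (nu (Tbdry_cyl x)).

Definition Tharmonic (par : V -> V) (lev : V -> int) (f : V -> R) : Prop :=
  forall x, f x - \sum_(y \in Tsucc par lev x) f y * (Tm_nu y / Tm_nu x) = 0.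

Definition Tpoisson (g : Omega -> R) (x : V) : R :=
  (Tm_nu x)^-1 * Rintegral nu (Tbdry_cyl x) g.

Definition Tin_Hardy (lev : V -> int) (p : \bar R) (f : V -> R) : Prop :=
  match p with
  | r%:E => (ereal_sup (range (fun k : int =>
        esum [set x | lev x = k] (fun x => (`|f x| `^ r * Tm_nu x)%:E)))
        < +oo)%E
  | +oo%E => (ereal_sup (range (fun x => (`|f x|)%:E)) < +oo)%E
  | -oo%E => False
  end.
End Boundary.

(* Main.v *)
(* The substantial direction is from H^p to L^p. Consider the step functions
   f_j on the boundary whose value on the cylinder of each vertex y of level
   -j is f(y). Harmonicity says that, for j large, the integral of f_j over
   the cylinder of x is f(x) m(x). Taking a limit of the integrals of f_j over
   A along a nonprincipal ultrafilter in j gives a set function Q(A) on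
   bounded measurable sets which is automatically finitely additive, with no
   convergence to check. The Hardy bound makes Q uniformly absolutely
   continuous, hence countably additive on each bounded set, and its
   Radon-Nikodym density g satisfies f = Pg. To see that g is in L^r, let N(A)
   be the same limit for |f_j|^r; Young's inequality r a^(r-1) |t| <= (r-1)
   a^r + |t|^r passes to the limit and gives a^r nu(A) <= N(A) whenever |g| >=
   a on A, while N is bounded by the r-th power of the Hardy norm. For p = oo
   the bound |Q(A)| <= C nu(A) suffices. Conversely, Jensen's inequality on
   each cylinder bounds Pg. *)
Require Import Defs.
From HB Require Import structures.
From mathcomp Require Import all_boot all_order all_algebra finmap.
From mathcomp Require Import all_classical all_reals all_analysis.
From mathcomp Require Import measurable_realfun ess_sup_inf ring lra zify.
Import Order.TTheory GRing.Theory Num.Theory.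
Import numFieldNormedType.Exports HBNNSimple.
Local Open Scope classical_set_scope.
Local Open Scope ring_scope.

Set Implicit Arguments.
Unset Strict Implicit.
Unset Printing Implicit Defensive.

(** * Limits of bounded sequences along an ultrafilter *)

(** Compactness of [-B, B] gives the image filter a cluster point. An ultrafilter contains the
    preimage of each neighbourhood or its complement, and the complement would contradict
    clustering. *)
Lemma ultrafilter_bounded_cvg (R : realType) (T : Type) (U : set_system T)
    (u : T -> R) (B : R) : UltraFilter U -> (forall n, `|u n| <= B) ->
  cvg (u n @[n --> U]).
Proof.
move=> UU uB; have FU : ProperFilter (u n @[n --> U]).
  exact: fmap_proper_filter.
have [l [_ ul]] : `[-B, B]%classic `&` cluster (u n @[n --> U]) !=set0.
  apply: (@segment_compact R (-B) B) => //=.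
  by apply: filterE => n /=; rewrite in_itv/= -ler_norml.
apply/cvg_ex; exists l => A lA.
have [//|UnA] := in_ultra_setVsetC (u @^-1` A) UU.
have [x [nAx Ax]] : (~` A) `&` A !=set0 by exact: ul.
by [].
Qed.

(** [L] is the limit along an ultrafilter refining the filter of cofinite sets. The refinement gives
    the last clause, through which harmonicity will determine [L]. *)
Lemma ultralimit (R : realType) : exists L : (nat -> R) -> R,
  let bounded u := exists B, forall n, `|u n| <= B in
  [/\ (forall u v, bounded u -> bounded v ->
        L (fun n => u n + v n) = L u + L v),
      (forall c u, bounded u -> L (fun n => c * u n) = c * L u),
      (forall u v, bounded u -> bounded v -> (forall n, `|u n| <= v n) ->
        `|L u| <= L v)
    & (forall u c, (\forall n \near \oo, u n = c) -> L u = c)].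
Proof.
have [U [UU sU]] := ultraFilterLemma (@eventually_filter).
exists (fun u => lim (u n @[n --> U])) => /=.
have cvU (u : nat -> R) : (exists B, forall n, `|u n| <= B) -> cvg (u n @[n --> U]).
  by move=> [B uB]; exact: ultrafilter_bounded_cvg uB.
split=> [u v /cvU cu /cvU cv|c u /cvU cu|u v /cvU cu /cvU cv uv|u c uc].
- by rewrite -limD.
- by apply/cvg_lim => //; exact: cvgMl_tmp.
- rewrite ler_norml -limN//; apply/andP; split; apply: ler_lim => //.
  + exact: is_cvgN.
  + by apply: nearW => n; have := uv n; rewrite ler_norml => /andP[].
  + by apply: nearW => n; have := uv n; rewrite ler_norml => /andP[].
- by apply: lim_near_cst => //; exact: sU.
Qed.

(** * Densities of finitely additive set functions *)

(** The bound by eps + K mu(A) is a uniform absolute continuity. It makes [Q] small on tails of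
    disjoint unions, which upgrades finite to countable additivity, and makes it vanish on null
    sets, so Radon-Nikodym applies. *)
Lemma content_density d (T : measurableType d) (R : realType)
    (mu : {measure set T -> \bar R}) (D : set T) (Q : set T -> R) :
  measurable D -> (mu D < +oo)%E ->
  (forall A B, measurable A -> measurable B -> A `<=` D -> B `<=` D ->
    A `&` B = set0 -> Q (A `|` B) = Q A + Q B) ->
  (forall eps, 0 < eps -> exists K, forall A, measurable A -> A `<=` D ->
    `|Q A| <= eps + K * fine (mu A)) ->
  exists h : T -> R, [/\ measurable_fun setT h, mu.-integrable D (EFin \o h)
    & forall A, measurable A -> A `<=` D -> Q A = Rintegral mu A h].
Proof.
move=> mD Doo QU Qac.
have mufin A : A `<=` D -> measurable A -> mu A \is a fin_num.
  move=> AD mA; rewrite ge0_fin_numE//.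
  by apply: le_lt_trans Doo; rewrite le_measure// inE.
pose q A := (Q (A `&` D))%:E.
have Q0 : Q set0 = 0.
  have := QU set0 set0 measurable0 measurable0 (@sub0set _ _) (@sub0set _ _).
  rewrite set0U set0I => /(_ erefl) /(congr1 (fun x => x - Q set0)).
  by rewrite subrr addrK.
have q0 : q set0 = 0%E by rewrite /q set0I Q0.
have qfin A : measurable A -> q A \is a fin_num by [].
have qsum F n : (forall i, measurable (F i)) -> trivIset setT F ->
    (\sum_(0 <= i < n) q (F i) = q (\bigcup_(i < n) F i))%E.
  move=> mF tF; elim: n => [|n IH]; first by rewrite big_geq// bigcup_mkord big_ord0.
  rewrite big_nat_recr//= IH /q -EFinD -QU.
  - by rewrite -setIUl !bigcup_mkord big_ord_recr.
  - by apply: measurableI => //; apply: bigcup_measurable.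
  - exact: measurableI.
  - exact: subIsetr.
  - exact: subIsetr.
  - rewrite -subset0 => x [[[i /= ltin Fi] _] [Fn _]].
    have := tF i n Logic.I Logic.I; rewrite /setI.
    move=> /(_ (ex_intro _ x (conj Fi Fn))) ein.
    by rewrite ein ltnn in ltin.
have qsig : semi_sigma_additive q.
  move=> F mF tF mUF.
  pose P n := \bigcup_(i < n) F i.
  (* The tail of the union inside [D]. These sets decrease to the empty set and have finite measure,
     so their measures tend to 0. *)
  pose G n := (\bigcup_i F i `\` P n) `&` D.
  have mP n : measurable (P n) by apply: bigcup_measurable.
  have mG n : measurable (G n) by apply: measurableI => //; apply: measurableD.
  have GD n : G n `<=` D by exact: subIsetr.
  have muG : (fine (mu (G n)) @[n --> \oo]) --> (0 : R).
    have -> : 0 = fine (mu (\bigcap_n G n)).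
      rewrite (_ : \bigcap_n _ = set0) ?measure0// -subset0 => x Gx.
      have [[[i _ Fi] _] _] := Gx 0%N Logic.I.
      have [[_ +] _] := Gx i.+1 Logic.I.
      by apply; exists i => //=.
    apply: fine_cvg; rewrite fineK; last first.
      apply: mufin; last exact: bigcap_measurable.
      by move=> x /(_ 0%N Logic.I)[].
    apply: nonincreasing_cvg_mu => //.
    - by rewrite -ge0_fin_numE// mufin.
    - exact: bigcap_measurable.
    - move=> m n mn; rewrite subsetEset => x [[Ux nPx] Dx]; split=> //; split=> //.
      move=> [i/= im Fi].
      by apply: nPx; exists i => //=; exact: leq_trans mn.
  rewrite (eq_cvg _ _ (fun n => qsum F n mF tF)).
  apply: cvg_EFin; first exact: nearW.
  apply/cvgrPdist_le => /= eps eps0.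
  have [K QK] := Qac _ (divr_gt0 eps0 (ltr0Sn R 1)).
  (* [K] may be zero or negative, so [|K| + 1] serves as the divisor. *)
  have K1 : 0 < `|K| + 1 by rewrite ltr_wpDl.
  have : \forall n \near \oo, `|0 - fine (mu (G n))| <= eps / 2 / (`|K| + 1).
    by move/cvgrPdist_le : muG; apply; rewrite !divr_gt0.
  apply: filterS => n; rewrite sub0r normrN ger0_norm ?fine_ge0// => Gn.
  rewrite (_ : \bigcup_n F n `&` D = (P n `&` D) `|` G n); last first.
    apply/seteqP; split => [x [[i _ Fi] Dx]|x].
      case: (pselect (P n x)) => Px; [by left|right].
      by split=> //; split=> //; exists i.
    by move=> [[[i _ Fi] Dx]|[[Ux _] Dx]]; split=> //; exists i.
  have PG : (P n `&` D) `&` G n = set0.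
    by rewrite -subset0 => x [[Px _] [[_ nPx] _]].
  rewrite (QU _ _ (measurableI _ _ (mP n) mD) (mG n) (@subIsetr _ _ _) (GD n) PG).
  rewrite addrAC subrr add0r; apply: le_trans (QK _ (mG n) (GD n)) _.
  rewrite [leRHS](splitr eps) lerD2l.
  apply: (@le_trans _ _ ((`|K| + 1) * fine (mu (G n)))).
    by rewrite ler_wpM2r ?fine_ge0//; apply: le_trans (ler_norm K) _; rewrite lerDl.
  by rewrite mulrC -ler_pdivlMr.
pose qc : {charge set T -> \bar R} := HB.pack q (isCharge.Build d T R q q0 qfin qsig).
(* The restriction of [mu] to [D] is finite on the whole space and agrees with [mu] on subsets of
   [D]. *)
pose mu' : {finite_measure set T -> \bar R} := mfrestr mD Doo.
have mu'E A : A `<=` D -> mu' A = mu A.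
  by move=> AD; rewrite /mu' /= /mfrestr /mrestr setIidl.
have qmu : qc `<< mu'.
  apply/null_content_dominatesP => A mA; rewrite /mu' /= /mfrestr /mrestr => muA.
  rewrite /q; congr EFin; apply/eqP; rewrite -normr_eq0 eq_le normr_ge0 andbT.
  apply/ler_addgt0Pr => eps eps0; rewrite add0r; have [K QK] := Qac _ eps0.
  apply: le_trans (QK _ (measurableI _ _ mA mD) (@subIsetr _ _ _)) _.
  by rewrite muA mulr0 addr0.
pose h := Radon_Nikodym qc mu'.
have hfin x : h x \is a fin_num by exact: Radon_Nikodym_fin_num.
have ih : mu'.-integrable setT h by exact: Radon_Nikodym_integrable.
have hE A : A `<=` D -> measurable A ->
    (\int[mu]_(x in A) h x = \int[mu']_(x in A) h x)%E.
  move=> AD mA; apply: eq_measure_integral => B mB BA.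
  by apply/esym/mu'E; exact: subset_trans AD.
have Eh : EFin \o (fine \o h) = h by apply/funext => x /=; rewrite fineK.
exists (fine \o h); split.
- by apply: measurableT_comp => //; exact: measurable_int ih.
- rewrite Eh; apply/integrableP; split.
    exact: measurable_funTS (measurable_int _ ih).
  have /integrableP[_] := integrableS measurableT mD (@subsetT _ _) ih.
  apply: le_lt_trans; rewrite le_eqVlt; apply/orP; left; apply/eqP.
  by apply: eq_measure_integral => B mB BD; exact/esym/mu'E.
- move=> A mA AD; rewrite /Rintegral.
  under eq_integral do rewrite fineK//.
  by rewrite hE// -Radon_Nikodym_integral//= /q setIidl.
Qed.

(** The increments [D n] of the exhaustion are disjoint with union [T]; the densities found on them
    are glued. Integrability is obtained on each [C n], not globally. *)
Lemma content_density_sigma_finite d (T : measurableType d) (R : realType)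
    (mu : {measure set T -> \bar R}) (C : nat -> set T) (Q : set T -> R) :
  (forall n, measurable (C n)) -> (forall n, (mu (C n) < +oo)%E) ->
  {homo C : m n / (m <= n)%N >-> m `<=` n} -> \bigcup_n C n = setT ->
  (forall n A B, measurable A -> measurable B -> A `<=` C n -> B `<=` C n ->
    A `&` B = set0 -> Q (A `|` B) = Q A + Q B) ->
  (forall n eps, 0 < eps -> exists K, forall A, measurable A -> A `<=` C n ->
    `|Q A| <= eps + K * fine (mu A)) ->
  exists g : T -> R, measurable_fun setT g /\
    forall n, mu.-integrable (C n) (EFin \o g) /\
      forall A, measurable A -> A `<=` C n -> Q A = Rintegral mu A g.
Proof.
move=> mC Coo ndC CT QU Qac.
pose D := seqD C.
have DC n : D n `<=` C n by case: n => [|n] // x [].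
have mD n : measurable (D n) by case: n => [|n]; [exact: mC|exact: measurableD].
have ndC' : {homo C : m n / (m <= n)%N >-> (m <= n)%O}.
  by move=> m n mn; rewrite subsetEset; exact: ndC.
have tD : trivIset setT D := trivIset_seqD ndC'.
have DT : \bigcup_n D n = setT by rewrite eq_bigcup_seqD.
have /choice[h hP] n : exists h : T -> R, [/\ measurable_fun setT h,
    mu.-integrable (D n) (EFin \o h) &
    forall A, measurable A -> A `<=` D n -> Q A = Rintegral mu A h].
  apply: content_density => //.
  - by apply: le_lt_trans (Coo n); rewrite le_measure// inE.
  - move=> A B mA mB AD BD; apply: (QU n) => //.
      exact: subset_trans AD (DC n).
    exact: subset_trans BD (DC n).
  - move=> eps /(Qac n)[K QK]; exists K => A mA AD.
    by apply: QK => //; exact: subset_trans AD (DC n).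
have /choice[k kP] x : exists n, D n x.
  by have : setT x by []; rewrite -DT => -[n _ Dn]; exists n.
pose g x := h (k x) x.
have gE n x : D n x -> g x = h n x.
  by move=> Dx; rewrite /g (tD (k x) n Logic.I Logic.I)//; exists x.
have mg : measurable_fun setT g.
  rewrite -DT; apply/measurable_fun_bigcup => // n.
  apply: (@eq_measurable_fun _ _ _ _ (D n) (h n)).
    by move=> x; rewrite inE => /gE.
  by apply: measurable_funTS; case: (hP n).
exists g; split => //.
have ig n : mu.-integrable (D n) (EFin \o g).
  have [_ ih _] := hP n; apply: eq_integrable ih => // x.
  by rewrite inE /= => /gE ->.
have Qg n A : measurable A -> A `<=` D n -> Q A = Rintegral mu A g.
  move=> mA AD; have [_ _ ->//] := hP n.
  by apply: eq_Rintegral => x; rewrite inE => /AD /gE.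
have CS n : C n.+1 = C n `|` D n.+1.
  by rewrite /D/= setDUK//; exact: ndC.
have CD n : [disjoint C n & D n.+1].
  by apply/eqP; rewrite /D/= setDE setICA setICr setI0.
(* Each step adds the single increment [D n.+1] to [C n], so only finite additivity is called
   for. *)
elim=> [|n [iC QC]]; first by split; [exact: (ig 0%N)|exact: (Qg 0%N)].
have iCS : mu.-integrable (C n.+1) (EFin \o g).
  apply/integrableP; split; first exact/measurable_EFinP/measurable_funTS.
  rewrite CS ge0_integral_setU//.
    have /integrableP[_ ?] := iC; have /integrableP[_ ?] := ig n.+1.
    exact: lte_add_pinfty.
  by apply: measurableT_comp => //; exact/measurable_EFinP/measurable_funTS.
split=> // A mA AC.
have AE : A = (A `&` C n) `|` (A `&` D n.+1) by rewrite -setIUr -CS; apply/esym/setIidl.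
have mAC : measurable (A `&` C n) by exact: measurableI.
have mAD : measurable (A `&` D n.+1) by exact: measurableI.
have dA : (A `&` C n) `&` (A `&` D n.+1) = set0.
  by rewrite setIACA (eqP (CD n)) setI0.
rewrite {1}AE (QU n.+1)//; [|by move=> x [/AC]..].
rewrite (QC _ mAC (@subIsetr _ _ _)).
rewrite (Qg n.+1 _ mAD (@subIsetr _ _ _)).
rewrite [in RHS]AE Rintegral_setU//; [rewrite -AE; exact: integrableS iCS|exact/eqP].
Qed.

(** * Integral bounds from finitely additive set functions *)

Lemma content_fsum d (T : measurableType d) (R : realType) (D : set T)
    (N : set T -> R) (I : choiceType) (K : set I) (F : I -> set T) :
  (forall A B, measurable A -> measurable B -> A `<=` D -> B `<=` D ->
    A `&` B = set0 -> N (A `|` B) = N A + N B) ->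
  finite_set K -> trivIset K F ->
  (forall i, K i -> measurable (F i)) -> (forall i, K i -> F i `<=` D) ->
  \sum_(i \in K) N (F i) = N (\bigcup_(i in K) F i).
Proof.
move=> NU Kfin tF mF FD.
have N0 : N set0 = 0.
  have := NU set0 set0 measurable0 measurable0 (@sub0set _ _) (@sub0set _ _).
  rewrite set0U set0I => /(_ erefl) /(congr1 (fun x => x - N set0)).
  by rewrite subrr addrK.
rewrite fsbig_finite//= -bigsetU_fset_set//.
have : {in enum_fset (fset_set K), forall i, K i}.
  by move=> i; rewrite -[_ \in _]/(i \in fset_set K) in_fset_set// inE.
elim: (enum_fset _) (fset_uniq (fset_set K)) => [|i s IH] /=; first by rewrite !big_nil.
move=> /andP[is_ us] sK; have Ki : K i by apply: sK; rewrite mem_head.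
have {}sK : {in s, forall i, K i} by move=> j js; apply: sK; rewrite inE js orbT.
rewrite !big_cons (IH us sK) NU//; first exact: mF.
- by rewrite big_seq; apply: bigsetU_measurable => j /sK /mF.
- exact: FD.
- by rewrite -bigcup_seq => x [j /= /sK /FD Fj /Fj].
- rewrite -subset0 -bigcup_seq => x [Fi [j /= js Fj]].
  have ij : i = j by apply: (tF i j) => //; [exact: sK|exists x].
  by rewrite ij js in is_.
Qed.

Lemma measurable_powR_norm d (T : measurableType d) (R : realType) (D : set T)
    (g : T -> R) (r : R) :
  measurable_fun D g -> measurable_fun D (fun x => (`|g x| `^ r)%:E).
Proof.
move=> mg; apply/measurable_EFinP.
by apply: (@measurableT_comp _ _ _ _ _ _ (@powR R ^~ r)) => //; exact: measurableT_comp.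
Qed.

(** A simple function below [|g|^r] on [C n] is compared with [N] on each of its level sets, and
    finite additivity bounds the sum by [M]. Monotone convergence then removes [C n]. *)
Lemma integral_powR_le_content d (T : measurableType d) (R : realType)
    (mu : {measure set T -> \bar R}) (C : nat -> set T) (g : T -> R)
    (N : set T -> R) (r M : R) :
  0 < r ->
  (forall n, measurable (C n)) ->
  {homo C : m n / (m <= n)%N >-> m `<=` n} -> \bigcup_n C n = setT ->
  measurable_fun setT g ->
  (forall n A B, measurable A -> measurable B -> A `<=` C n -> B `<=` C n ->
    A `&` B = set0 -> N (A `|` B) = N A + N B) ->
  (forall n A, measurable A -> A `<=` C n -> 0 <= N A <= M) ->
  (forall n A (a : R), measurable A -> A `<=` C n -> 0 <= a ->
    (forall x, A x -> a <= `|g x|) -> ((a `^ r)%:E * mu A <= (N A)%:E)%E) ->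
  (\int[mu]_x (`|g x| `^ r)%:E <= M%:E)%E.
Proof.
move=> r0 mC ndC CT mg NU NM gN.
have mgr : measurable_fun setT (fun x => (`|g x| `^ r)%:E).
  exact: measurable_powR_norm.
have bound n : (\int[mu]_(x in C n) (`|g x| `^ r)%:E <= M%:E)%E.
  rewrite ge0_integralE; last by move=> x _; rewrite lee_fin powR_ge0.
  apply: ge_ereal_sup => _ [h /= hg <-]; rewrite sintegralE.
  pose F y := h @^-1` [set y] `&` C n.
  have mh y : measurable (h @^-1` [set y]) by [].
  have mF y : measurable (F y) by exact: measurableI.
  have FC y : F y `<=` C n by exact: subIsetr.
  have tF : trivIset (range h) F by move=> i j _ _ [x [[/= <- _] [/= <- _]]].
  apply: (@le_trans _ _ (\sum_(y \in range h) (N (F y))%:E)%E).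
    apply: lee_fsum => // _ [x _ <-]; set y := h x.
    (* The level set of 0 may leave [C n], but its term vanishes. A positive value is taken only
       inside [C n], because the function extended by 0 vanishes outside. *)
    have : 0 <= y by exact: fun_ge0.
    rewrite le_eqVlt => /predU1P[<-|y0].
      by rewrite mul0e lee_fin; have /andP[] := NM n (F 0) (mF 0) (FC 0).
    have hF : h @^-1` [set y] = F y.
      apply/esym/setIidl => z /= hz; apply: contrapT => nCz.
      have := hg z; rewrite patchE memNset// hz lee_fin.
      by rewrite leNgt y0.
    (* Where the simple function equals y, [|g|] is at least y^(1/r); this is the threshold given to
       [gN]. *)
    have yE : y = (y `^ r^-1) `^ r by rewrite -powRrM mulVf ?gt_eqF// powRr1// ltW.
    rewrite hF {1}yE; apply: (gN n) => //; first exact: powR_ge0.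
    move=> z [/= hz Cz]; have := hg z.
    rewrite patchE mem_set// hz lee_fin => ygr.
    have -> : `|g z| = (`|g z| `^ r) `^ r^-1.
      by rewrite -powRrM mulfV ?gt_eqF// powRr1.
    apply: ge0_ler_powR => //; rewrite ?nnegrE ?powR_ge0 ?invr_ge0 ?(ltW r0)//; exact: ltW.
  rewrite fsumEFin// lee_fin (@content_fsum _ _ _ (C n))//; last exact: NU.
  have [] := andP (NM n (\bigcup_(i in range h) F i) _ _) => //.
    by apply: fin_bigcup_measurable.
  by move=> x [i _ []].
have := @ge0_nondecreasing_set_cvg_integral _ _ _ C _ mu _ mC.
rewrite CT => cvI.
have {}cvI : (\int[mu]_(x in C n) (`|g x| `^ r)%:E @[n --> \oo] -->
    \int[mu]_x (`|g x| `^ r)%:E)%E.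
  apply: cvI => [m n /ndC|n|n x _]; first by rewrite subsetEset.
    exact: measurable_funTS.
  by rewrite lee_fin powR_ge0.
rewrite -(cvg_lim _ cvI)//; apply: lime_le; first by apply/cvg_ex; eexists; exact: cvI.
exact: nearW.
Qed.

(** * Inequalities of Young and Jensen *)

(** The tangent line of t^r at [a] lies below the graph. This is Young's inequality for [t] and
    a^(r-1) with conjugate exponents r and r/(r-1), multiplied by r. *)
Lemma young_powR (R : realType) (r a t : R) : 1 < r -> 0 <= a -> 0 <= t ->
  r * a `^ (r - 1) * t <= (r - 1) * a `^ r + t `^ r.
Proof.
move=> r1 a0 t0; have r0 : 0 < r by lra.
have r10 : 0 < r - 1 by lra.
have : t * a `^ (r - 1) <= t `^ r / r + (a `^ (r - 1)) `^ (r / (r - 1)) / (r / (r - 1)).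
  apply: conjugate_powR => //; rewrite ?powR_ge0 ?divr_gt0//.
  by field; rewrite ?gt_eqF.
rewrite -powRrM mulrCA divff ?mulr1 ?gt_eqF// => h.
rewrite -(ler_pM2l r0) in h.
apply: le_trans (_ : _ <= r * (t `^ r / r + a `^ r / (r / (r - 1)))) _.
  by apply: le_trans h; rewrite le_eqVlt; apply/orP; left; apply/eqP; ring.
by rewrite le_eqVlt; apply/orP; left; apply/eqP; field; rewrite !gt_eqF.
Qed.

Lemma powR_mul_sub1 (R : realType) (r a : R) : 1 < r -> 0 <= a ->
  a `^ (r - 1) * a = a `^ r.
Proof.
move=> r1; rewrite le_eqVlt => /predU1P[<-|a0].
  by rewrite mulr0 powR0// gt_eqF//; lra.
by rewrite -[X in _ * X]powRr1 ?ltW// -powRD ?subrK// (gt_eqF a0) implybT.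
Qed.

Lemma integrable_cst_on d (T : measurableType d) (R : realType)
    (mu : {measure set T -> \bar R}) (A : set T) (k : R) :
  measurable A -> (mu A < +oo)%E -> mu.-integrable A (EFin \o cst k).
Proof.
move=> mA Aoo; apply/integrableP; split; first exact/measurable_EFinP.
by rewrite /= integral_cst// lte_mul_pinfty.
Qed.

(** A one-sided bound rules out cancellation; sets on which only [|g|] is bounded below are first
    split by the sign of [g]. *)
Lemma le_normr_Rintegral_cst d (T : measurableType d) (R : realType)
    (mu : {measure set T -> \bar R}) (A : set T) (g : T -> R) (a : R) :
  measurable A -> (mu A < +oo)%E -> mu.-integrable A (EFin \o g) ->
  (forall x, A x -> a <= g x) \/ (forall x, A x -> g x <= - a) ->
  a * fine (mu A) <= `|Rintegral mu A g|.
Proof.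
move=> mA Aoo ig [] ag.
  rewrite -Rintegral_cst//; apply: le_trans (ler_norm _).
  by apply: le_Rintegral => //; exact: integrable_cst_on.
rewrite -normrN; apply: le_trans (ler_norm _).
rewrite lerNr -mulNr -Rintegral_cst//.
by apply: le_Rintegral => //; exact: integrable_cst_on.
Qed.

(* Jensen's inequality for t |-> |t|^r, obtained by integrating the tangent
   line inequality at the mean. *)
Lemma powR_mean_le d (T : measurableType d) (R : realType)
    (mu : {measure set T -> \bar R}) (A : set T) (g : T -> R) (r : R) :
  1 < r -> measurable A -> (0 < mu A)%E -> (mu A < +oo)%E ->
  measurable_fun A g ->
  ((`|(fine (mu A))^-1 * Rintegral mu A g| `^ r * fine (mu A))%:E <=
    \int[mu]_(x in A) (`|g x| `^ r)%:E)%E.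
Proof.
move=> r1 mA A0 Aoo mg; set c := _^-1 * _; set a := `|c|.
have r0 : 0 < r by lra.
have mgr := measurable_powR_norm r mg.
have g0 x : A x -> (0 <= (`|g x| `^ r)%:E)%E by rewrite lee_fin powR_ge0.
have [goo|] := ltP (\int[mu]_(x in A) (`|g x| `^ r)%:E)%E +oo%E; last first.
  by rewrite leye_eq => /eqP ->; rewrite leey.
have igr : mu.-integrable A (EFin \o (fun x => `|g x| `^ r)).
  apply/integrableP; split => //; apply: le_lt_trans goo.
  rewrite le_eqVlt; apply/orP; left; apply/eqP; apply: eq_integral => x _.
  by rewrite /= ger0_norm// powR_ge0.
have icst b : mu.-integrable A (EFin \o cst (b : R)).
  exact: integrable_cst_on.
have young b x : 0 <= b -> r * b `^ (r - 1) * `|g x| <= (r - 1) * b `^ r + `|g x| `^ r.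
  by move=> b0; exact: young_powR.
have ignorm : mu.-integrable A (EFin \o (fun x => `|g x|)).
  apply: (@le_integrable _ _ _ mu A mA _ (EFin \o (fun x => (r - 1) + `|g x| `^ r))).
  - by apply/measurable_EFinP; exact: measurableT_comp.
  - move=> x _ /=; rewrite lee_fin normr_id [leRHS]ger0_norm; last first.
      by apply: addr_ge0; [rewrite subr_ge0 ltW|exact: powR_ge0].
    (* The tangent at 1 dominates [|g|] by an integrable function, since r >= 1. *)
    have := young 1 x ler01; rewrite !powR1 !mulr1; apply: le_trans.
    by rewrite ler_peMl// ltW.
  - exact: (integrableD mA (icst (r - 1)) igr).
have ig : mu.-integrable A (EFin \o g).
  apply/integrableP; split; first exact/measurable_EFinP.
  have /integrableP[_] := ignorm; apply: le_lt_trans.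
  rewrite le_eqVlt; apply/orP; left; apply/eqP.
  by apply: eq_integral => x _ /=; rewrite normr_id.
have mu0 : 0 < fine (mu A) by rewrite fine_gt0// A0.
have key : r * a `^ (r - 1) * \int[mu]_(x in A) `|g x| <=
    (r - 1) * a `^ r * fine (mu A) + \int[mu]_(x in A) (`|g x| `^ r).
  rewrite -RintegralZl// -Rintegral_cst// -RintegralD//; last exact: icst.
  apply: le_Rintegral => //.
  - exact: (integrableZl mA (r * a `^ (r - 1)) ignorm).
  - exact: (integrableD mA (icst _) igr).
  - by move=> x _; exact: (young _ _ (normr_ge0 c)).
have ac : a * fine (mu A) <= \int[mu]_(x in A) `|g x|.
  rewrite /a /c normrM gtr0_norm ?invr_gt0// mulrAC mulVf ?gt_eqF// mul1r.
  exact: le_normr_Rintegral.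
have -> : (\int[mu]_(x in A) (`|g x| `^ r)%:E)%E = (\int[mu]_(x in A) (`|g x| `^ r))%:E.
  by rewrite /Rintegral fineK// ge0_fin_numE// integral_ge0.
(* After this addition the left side is r a^r mu(A), which [ac] bounds by the left side of [key]. *)
rewrite lee_fin -(lerD2l ((r - 1) * a `^ r * fine (mu A))).
apply: le_trans key; rewrite -mulrA.
apply: le_trans (_ : _ <= r * (a `^ (r - 1) * (a * fine (mu A)))) _; last first.
  by rewrite -[leRHS]mulrA ler_wpM2l ?ler_wpM2l ?powR_ge0// ltW.
rewrite [X in _ <= r * X]mulrA powR_mul_sub1 ?normr_ge0//.
by rewrite le_eqVlt; apply/orP; left; apply/eqP; ring.
Qed.

Lemma ler_fsum (R : realDomainType) (I : choiceType) (P : set I) (F G : I -> R) :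
  finite_set P -> (forall i, P i -> F i <= G i) ->
  \sum_(i \in P) F i <= \sum_(i \in P) G i.
Proof.
by move=> Pfin FG; rewrite -lee_fin -!fsumEFin//; apply: lee_fsum => // i /FG.
Qed.

(** * Cylinders and trunks in the boundary of the tree *)

Section TreeBoundary.
Context (V : choiceType) (par : V -> V) (lev : V -> int) (o : V).
Context (d : measure_display) (Omega : measurableType d) (R : realType).
Context (e : Omega -> (int -> V)) (nu : {measure set Omega -> \bar R}).
Hypothesis tree : Ttree_with_end par lev o.
Hypothesis locfin : Tlocally_finite par.
Hypothesis bdry : Tboundary_model e par lev.
Hypothesis nu_cyl :
  forall x, (0 < nu (Tbdry_cyl e x))%E /\ (nu (Tbdry_cyl e x) < +oo)%E.

Local Notation cyl := (Tbdry_cyl e).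
Local Notation m := (Tm_nu e nu).

Lemma lev_iter n x : lev (iter n par x) = lev x + n%:Z.
Proof.
case: tree => levS _ _; elim: n => [|n IH] /=; first by rewrite addr0.
by rewrite levS IH -addrA -addn1 PoszD.
Qed.

Lemma lev_root n : lev (iter n par o) = n%:Z.
Proof. by rewrite lev_iter; case: tree => _ -> _; rewrite add0r. Qed.

Lemma lev_end w k : lev (e w k) = k.
Proof. by case: bdry => /(_ w k)[_ ->]. Qed.

Lemma end_iter w k n : e w (k + n%:Z) = iter n par (e w k).
Proof.
elim: n => [|n IH] /=; first by rewrite addr0.
by rewrite -IH; case: bdry => /(_ w (k + n%:Z))[-> _] _ _ _; rewrite -addrA -PoszD addn1.
Qed.

Lemma cylP x w : cyl x w <-> e w (lev x) = x.
Proof. by split=> [[k <-]|ex]; [rewrite lev_end|exists (lev x)]. Qed.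

Lemma measurable_cyl x : measurable (cyl x).
Proof.
case: bdry => _ _ _ mE.
suff : (@measurable d Omega) (cyl x) by [].
by rewrite mE; apply: sub_gen_smallest; exists x.
Qed.
Local Hint Resolve measurable_cyl : core.

Lemma cyl_inj x y w : lev x = lev y -> cyl x w -> cyl y w -> x = y.
Proof. by move=> xy /cylP <- /cylP <-; rewrite xy. Qed.

Lemma sub_cyl_iter n x : cyl x `<=` cyl (iter n par x).
Proof. by move=> w /cylP wx; apply/cylP; rewrite lev_iter end_iter wx. Qed.

(** An increasing exhaustion of the boundary by sets of finite measure; it covers because every
    vertex has a common ancestor with [o]. *)
Definition trunk n : set Omega := cyl (iter n par o).

Lemma measurable_trunk n : measurable (trunk n). Proof. exact: measurable_cyl. Qed.
Local Hint Resolve measurable_trunk : core.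

Lemma sub_trunk : {homo trunk : m n / (m <= n)%N >-> m `<=` n}.
Proof.
move=> i j ij; rewrite /trunk -(subnK ij) iterD.
exact: sub_cyl_iter.
Qed.

Lemma cyl_sub_trunk x : exists n, cyl x `<=` trunk n.
Proof.
case: tree => _ _ /(_ x o)[a [b ab]]; exists b.
by rewrite /trunk -ab; exact: sub_cyl_iter.
Qed.

Lemma bigcup_trunk : \bigcup_n trunk n = setT.
Proof.
rewrite -subTset => w _; have [n] := cyl_sub_trunk (e w 0).
by move=> /(_ w) Cw; exists n => //; apply: Cw; exists 0.
Qed.

(** Local finiteness enters here; it makes level sums over a trunk and sums over successors
    finite. *)
Lemma finite_descendants n x : finite_set [set y | iter n par y = x].
Proof.
elim: n x => [|n IH] x; first by rewrite (_ : [set _ | _] = [set x])//; exact: finite_set1.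
rewrite (_ : [set _ | _] =
    \bigcup_(z in [set z | par z = x]) [set y | iter n par y = z]).
  apply: bigcup_finite => //.
  apply: sub_finite_set (locfin x) => z /= <-; by right.
by apply/seteqP; split=> [y /= <-|y [z /= <- <-]//]; exists (iter n par y).
Qed.

Lemma fin_num_nu A x : measurable A -> A `<=` cyl x -> nu A \is a fin_num.
Proof.
move=> mA Ax; rewrite ge0_fin_numE//; apply: le_lt_trans (nu_cyl x).2.
by rewrite le_measure// inE.
Qed.

Lemma m_gt0 x : 0 < m x.
Proof. by rewrite fine_gt0//; have [-> ->] := nu_cyl x. Qed.

(** * Sums over one level of the tree *)

(** The vertex [iter n par o] has level n, so its descendants of level -j lie n + j steps below
    it. *)
Definition slice n j : set V := [set y | iter (n + j) par y = iter n par o].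

Lemma finite_slice n j : finite_set (slice n j).
Proof. exact: finite_descendants. Qed.
Local Hint Resolve finite_slice : core.

Lemma lev_slice n j y : slice n j y -> lev y = - j%:Z.
Proof.
move=> /(congr1 lev); rewrite lev_iter lev_root PoszD => yn.
by apply: (addrI (n%:Z + j%:Z)); rewrite addrC yn addrK.
Qed.

(** Both vertices lie on the geodesic [e w], at levels -j and n, hence n + j parent steps apart. *)
Lemma slice_meet n j y w : lev y = - j%:Z -> trunk n w -> cyl y w -> slice n j y.
Proof.
move=> levy /cylP; rewrite lev_root => nw /cylP yw.
rewrite /slice/= -nw -yw -end_iter levy; congr (e w _).
by rewrite PoszD addrC addrK.
Qed.

(* [level_sum j phi A] is the integral over [A] of the function equal to [phi
   y] on the cylinder of each vertex [y] of level [-j]; the sum is finite when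
   [A] lies in some [trunk n]. *)
Definition level_sum (j : nat) (phi : V -> R) (A : set Omega) : R :=
  \sum_(y \in [set y | lev y = - j%:Z]) phi y * fine (nu (A `&` cyl y)).

(** A level may be infinite, but the cylinders of its vertices outside the slice miss the trunk and
    contribute 0. *)
Lemma level_sumE n j phi A : A `<=` trunk n ->
  level_sum j phi A = \sum_(y \in slice n j) phi y * fine (nu (A `&` cyl y)).
Proof.
move=> An; apply/esym/fsbig_widen => y; first exact: lev_slice.
move=> [/= levy nSy]; rewrite (_ : A `&` _ = set0) ?measure0 ?mulr0//.
by rewrite -subset0 => w [/An nw yw]; apply: nSy; exact: slice_meet yw.
Qed.

Lemma fine_nuU A B x : measurable A -> measurable B -> A `<=` cyl x ->
  B `<=` cyl x -> A `&` B = set0 -> fine (nu (A `|` B)) = fine (nu A) + fine (nu B).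
Proof.
move=> mA mB Ax Bx AB; rewrite measureU// fineD//.
  exact: fin_num_nu Ax.
exact: fin_num_nu Bx.
Qed.

Lemma level_sumU n j phi A B : measurable A -> measurable B ->
  A `<=` trunk n -> B `<=` trunk n -> A `&` B = set0 ->
  level_sum j phi (A `|` B) = level_sum j phi A + level_sum j phi B.
Proof.
move=> mA mB An Bn AB; rewrite !(@level_sumE n)//; last by rewrite subUset.
rewrite -fsbig_split//; apply: eq_fsbigr => y _.
rewrite setIUl (@fine_nuU _ _ (iter n par o)) ?mulrDr//.
- exact: measurableI.
- exact: measurableI.
- by move=> w [/An].
- by move=> w [/Bn].
- by rewrite setIACA AB set0I.
Qed.

Lemma fine_nu_slice n j A : measurable A -> A `<=` trunk n ->
  fine (nu A) = \sum_(y \in slice n j) fine (nu (A `&` cyl y)).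
Proof.
move=> mA An.
have AE : A = \bigcup_(y in slice n j) (A `&` cyl y).
  apply/seteqP; split=> [w Aw|w [y _ []//]].
  (* Each end passes through exactly one vertex of level -j, so the cylinders of that level
     partition the trunk. *)
  exists (e w (- j%:Z)); last by split=> //; exists (- j%:Z).
  by apply: slice_meet (An _ Aw) _; [exact: lev_end|exists (- j%:Z)].
apply: EFin_inj; rewrite -fsumEFin// fineK ?(fin_num_nu mA An)//.
rewrite {1}AE measure_fin_bigcup//.
- apply: eq_fsbigr => y _; rewrite fineK// (@fin_num_nu _ (iter n par o))//.
    exact: measurableI.
  by move=> w [/An].
- move=> x y xS yS [w [[_ xw] [_ yw]]].
  by apply: cyl_inj xw yw; rewrite (lev_slice xS) (lev_slice yS).
- by move=> y _; exact: measurableI.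
Qed.

Lemma level_sum_cst n j c A : measurable A -> A `<=` trunk n ->
  level_sum j (fun=> c) A = c * fine (nu A).
Proof.
by move=> mA An; rewrite (level_sumE _ _ An) (fine_nu_slice j mA An) mulr_fsumr.
Qed.

Lemma level_sumD n j phi psi A : A `<=` trunk n ->
  level_sum j (fun y => phi y + psi y) A = level_sum j phi A + level_sum j psi A.
Proof.
move=> An; rewrite !(level_sumE _ _ An) -fsbig_split//.
by apply: eq_fsbigr => y _; rewrite mulrDl.
Qed.

Lemma level_sumZ j c phi A :
  level_sum j (fun y => c * phi y) A = c * level_sum j phi A.
Proof. by rewrite /level_sum mulr_fsumr; apply: eq_fsbigr => y _; rewrite mulrA. Qed.

Lemma level_sum_le n j phi psi A : A `<=` trunk n -> (forall y, phi y <= psi y) ->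
  level_sum j phi A <= level_sum j psi A.
Proof.
move=> An le; rewrite !(level_sumE _ _ An); apply: ler_fsum => // y _.
by rewrite ler_wpM2r ?fine_ge0.
Qed.

Lemma normr_level_sum n j phi A : A `<=` trunk n ->
  `|level_sum j phi A| <= level_sum j (fun y => `|phi y|) A.
Proof.
move=> An; rewrite !(level_sumE _ _ An) !fsbig_finite//=.
apply: le_trans (ler_norm_sum _ _ _) _; apply: ler_sum => y _.
by rewrite normrM [X in _ * X <= _]ger0_norm ?fine_ge0.
Qed.

(** * Harmonicity and the density on the boundary *)

(** The other adjacency, [par x = y], would put [y] one level above [x]. *)
Lemma Tsucc_par x y : Tsucc par lev x y <-> par y = x.
Proof.
case: tree => levS _ _; split=> [[[//|<-]]|<-]; last first.
  by split; [left|rewrite levS addrK].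
by rewrite levS => /eqP; rewrite -subr_eq0; lia.
Qed.

Lemma finite_Tsucc x : finite_set (Tsucc par lev x).
Proof.
apply: sub_finite_set (@finite_descendants 1 x) => y /Tsucc_par; exact.
Qed.

Lemma cyl_succ x : cyl x = \bigcup_(y in Tsucc par lev x) cyl y.
Proof.
apply/seteqP; split=> [w /cylP wx|w [y /Tsucc_par <-]].
  exists (e w (lev x - 1)); last by exists (lev x - 1).
  by apply/Tsucc_par; rewrite -[LHS](end_iter w (lev x - 1) 1) subrK.
exact: (@sub_cyl_iter 1).
Qed.

Lemma trivIset_succ x : trivIset (Tsucc par lev x) cyl.
Proof.
move=> y z [_ ly] [_ lz] [w [yw zw]].
by apply: cyl_inj yw zw; rewrite ly lz.
Qed.

(** Induction on the height of [x] above level -j. At height 0 only [x] contributes; above it, the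
    cylinder splits into those of the successors, and harmonicity recombines their terms f(y) m(y)
    into f(x) m(x). *)
Lemma level_sum_harmonic f j x : Tharmonic e nu par lev f ->
  - j%:Z <= lev x -> level_sum j f (cyl x) = f x * m x.
Proof.
move=> harm; rewrite -subr_ge0; case E : (lev x - _) => [N|//] _.
elim: N x E => [|N IH] x E.
  have xj : lev x = - j%:Z by lia.
  rewrite /level_sum -(@fsbig_widen _ _ _ _ [set x])/=.
  - by rewrite fsbig_set1 setIid.
  - by move=> y ->.
  - move=> y [/= yj yx]; rewrite (_ : _ `&` _ = set0) ?measure0 ?mulr0//.
    rewrite -subset0 => w [xw yw]; apply: yx.
    by apply: cyl_inj yw xw; rewrite yj xj.
have [n xn] := cyl_sub_trunk x.
rewrite cyl_succ -(@content_fsum _ _ _ (trunk n) (level_sum j f)).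
- have /eqP := harm x; rewrite subr_eq0 => /eqP ->; rewrite mulr_fsuml.
  apply: eq_fsbigr => y; rewrite inE => -[_ ly].
  by rewrite IH; [rewrite -mulrA divfK ?gt_eqF// m_gt0|lia].
- exact: level_sumU.
- exact: finite_Tsucc.
- exact: trivIset_succ.
- by move=> y _; exact: measurable_cyl.
- by move=> y sy w yw; apply: xn; rewrite cyl_succ; exists y.
Qed.

(** This is the argument common to finite and infinite exponents, which differ in how they prove the
    domination of [L]. On the cylinder of [x] the level sums are eventually f(x) m(x), so [L]
    returns that value. *)
Lemma Tharmonic_density f (L : (nat -> R) -> R) :
  (forall u v, (exists B, forall n, `|u n| <= B) ->
    (exists B, forall n, `|v n| <= B) -> L (fun n => u n + v n) = L u + L v) ->
  (forall u c, (\forall n \near \oo, u n = c) -> L u = c) ->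
  Tharmonic e nu par lev f ->
  (forall n A, measurable A -> A `<=` trunk n ->
    exists B, forall j, `|level_sum j f A| <= B) ->
  (forall n eps, 0 < eps -> exists K, forall A, measurable A -> A `<=` trunk n ->
    `|L (fun j => level_sum j f A)| <= eps + K * fine (nu A)) ->
  exists g : Omega -> R, [/\ measurable_fun setT g,
    (forall n, nu.-integrable (trunk n) (EFin \o g) /\
      forall A, measurable A -> A `<=` trunk n ->
        L (fun j => level_sum j f A) = Rintegral nu A g)
    & forall x, f x = Tpoisson e nu g x].
Proof.
move=> LD Lev harm fB Lac.
have [||g [mg gP]] := @content_density_sigma_finite _ _ _ nu trunk
    (fun A => L (fun j => level_sum j f A)) measurable_trunk _
    sub_trunk bigcup_trunk _ Lac.
- by move=> n; case: (nu_cyl (iter n par o)).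
- move=> n A B mA mB An Bn AB; rewrite -LD; [|exact: fB An|exact: fB Bn].
  by congr L; apply/funext => j; exact: (level_sumU j f mA mB An Bn AB).
exists g; split=> // x; have [n xn] := cyl_sub_trunk x.
rewrite /Tpoisson; have [_ <-//] := gP n.
rewrite (Lev _ (f x * m x)); first by rewrite mulrC mulfK// gt_eqF// m_gt0.
near=> j; apply: level_sum_harmonic => //.
have : (`|lev x| <= j)%N by near: j; exact: nbhs_infty_ge.
by lia.
Unshelve. all: by end_near. Qed.

(** * From the Hardy space to boundary functions *)

(** The tangent inequality is used at three kinds of points: at 1 for boundedness of the level sums,
    at a large point for absolute continuity, and at a lower bound of [|g|] for the L^r estimate. *)
Lemma Tin_Hardy_Lfun_fin (r : R) f : 1 < r -> Tharmonic e nu par lev f ->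
  Tin_Hardy e nu lev r%:E f ->
  exists g : Omega -> R, g \in @Lfun _ Omega R nu r%:E /\
    forall x, f x = Tpoisson e nu g x.
Proof.
move=> r1 harm /= Hoo; have r0 : 0 < r by lra.
set S := ereal_sup _ in Hoo.
have Sle k : (\esum_(x in [set x | lev x = k]) (`|f x| `^ r * m x)%:E <= S)%E.
  by apply: ereal_sup_ubound; exists k.
have S0 : (0 <= S)%E.
  apply: le_trans (Sle 0); apply: esum_ge0 => x _.
  by rewrite lee_fin mulr_ge0 ?powR_ge0// ltW// m_gt0.
have Sfin : S \is a fin_num by rewrite ge0_fin_numE.
pose M := fine S.
pose fr y := `|f y| `^ r.
have frM n j A : measurable A -> A `<=` trunk n -> 0 <= level_sum j fr A <= M.
  move=> mA An; rewrite (level_sumE _ _ An); apply/andP; split.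
    by apply: fsumr_ge0 => y _; rewrite mulr_ge0 ?powR_ge0 ?fine_ge0.
  rewrite -lee_fin fineK// -fsumEFin//; apply: le_trans (Sle (- j%:Z)).
  apply: esum_ge; exists (slice n j).
    by split=> // y; exact: lev_slice.
  apply: lee_fsum => // y _; rewrite lee_fin ler_wpM2l ?powR_ge0//.
  have mAy : measurable (A `&` cyl y) by exact: measurableI.
  have Ay : A `&` cyl y `<=` cyl y by exact: subIsetr.
  apply: fine_le; last by rewrite le_measure// inE.
    exact: fin_num_nu mAy Ay.
  exact: (@fin_num_nu _ y).
have tangent n j A a : measurable A -> A `<=` trunk n -> 0 <= a ->
    r * a `^ (r - 1) * `|level_sum j f A| <=
    (r - 1) * a `^ r * fine (nu A) + level_sum j fr A.
  move=> mA An a0.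
  apply: le_trans (_ : _ <= r * a `^ (r - 1) * level_sum j (fun y => `|f y|) A) _.
    apply: ler_wpM2l; last exact: normr_level_sum An.
    by rewrite mulr_ge0 ?powR_ge0// ltW.
  rewrite -level_sumZ -(@level_sum_cst n j)// -(level_sumD _ _ _ An).
  by apply: level_sum_le An _ => y; exact: young_powR.
have fB n A : measurable A -> A `<=` trunk n ->
    exists B, forall j, `|level_sum j f A| <= B.
  move=> mA An; exists ((r - 1) * fine (nu A) + M) => j.
  have := tangent n j A 1 mA An ler01; rewrite !powR1 !mulr1 => h.
  apply: le_trans (_ : _ <= r * `|level_sum j f A|) _.
    by rewrite ler_peMl// ltW.
  by apply: le_trans h _; rewrite lerD2l; case/andP: (frM n j A mA An).
have frB n A : measurable A -> A `<=` trunk n ->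
    exists B, forall j, `|level_sum j fr A| <= B.
  move=> mA An; exists M => j; have /andP[? ?] := frM n j A mA An.
  by rewrite ger0_norm.
have [L [LD LZ Lle Lev]] := ultralimit R.
have Lcst c : L (fun=> c) = c by apply: Lev; exact: nearW.
have cB c : exists B, forall n : nat, `|(fun=> c) n| <= B :> R by exists `|c|.
pose Q A := L (fun j => level_sum j f A).
pose N A := L (fun j => level_sum j fr A).
have NM n A : measurable A -> A `<=` trunk n -> 0 <= N A <= M.
  move=> mA An; have frA j := frM n j A mA An; apply/andP; split.
    apply: le_trans (normr_ge0 (L (fun=> 0))) _.
    apply: Lle => [||j]; [exact: cB|exact: frB An|].
    by rewrite normr0; case/andP: (frA j).
  apply: le_trans (ler_norm _) _; rewrite -[leRHS]Lcst.
  apply: Lle => [||j]; [exact: frB An|exact: cB|].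
  by have /andP[? ?] := frA j; rewrite ger0_norm.
have QN n A (a : R) : measurable A -> A `<=` trunk n -> 0 <= a ->
    r * a `^ (r - 1) * `|Q A| <= (r - 1) * a `^ r * fine (nu A) + N A.
  move=> mA An a0; set b := r * _; set c := _ * fine _.
  have b0 : 0 <= b by rewrite mulr_ge0 ?powR_ge0// ltW.
  (* The left side becomes the absolute value of an [L], the form required by [Lle]. *)
  rewrite -[leLHS](ger0_norm (mulr_ge0 b0 (normr_ge0 _))) normrM normr_id -normrM.
  rewrite -LZ; last exact: fB An.
  rewrite -[c]Lcst -LD; [|exact: cB|exact: frB An].
  apply: Lle => [||j].
  - have [B fAB] := fB _ _ mA An; exists (b * B) => j.
    by rewrite normrM (ger0_norm b0) ler_wpM2l.
  - have [B fAB] := frB _ _ mA An; exists (`|c| + B) => j.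
    by apply: le_trans (ler_normD _ _) _; rewrite lerD2l.
  - by rewrite normrM (ger0_norm b0); exact: tangent An a0.
have NU n A B : measurable A -> measurable B -> A `<=` trunk n ->
    B `<=` trunk n -> A `&` B = set0 -> N (A `|` B) = N A + N B.
  move=> mA mB An Bn AB; rewrite /N -LD; [|exact: frB An|exact: frB Bn].
  by congr L; apply/funext => j; exact: (level_sumU j fr mA mB An Bn AB).
have [n eps eps0|g [mg gQ fg]] := Tharmonic_density LD Lev harm fB.
  have M0 : 0 <= M by exact: fine_ge0.
  (* Dividing [QN] by r b leaves the error M / (r b), and this [b] makes it at most eps. The point
     [a] solves a^(r-1) = b. *)
  pose b := M / eps + 1; have b0 : 0 < b by rewrite ltr_wpDl// divr_ge0// ltW.
  pose a := b `^ (r - 1)^-1.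
  have ab : a `^ (r - 1) = b.
    by rewrite -powRrM mulVf ?powRr1// ?gt_eqF ?subr_gt0// ltW.
  exists ((r - 1) * a `^ r / (r * b)) => A mA An.
  have rb0 : 0 < r * b by exact: mulr_gt0.
  have /andP[_ NAM] := NM n A mA An.
  have QAa := QN n A a mA An (powR_ge0 _ _); rewrite ab in QAa.
  rewrite -(ler_pM2l rb0); apply: le_trans QAa _.
  have -> : r * b * (eps + (r - 1) * a `^ r / (r * b) * fine (nu A)) =
      r * b * eps + (r - 1) * a `^ r * fine (nu A).
    by field; rewrite !gt_eqF.
  have : M <= r * b * eps.
    have -> : r * b * eps = r * (M + eps) by rewrite /b; field; rewrite gt_eqF.
    by nra.
  by lra.
exists g; split=> //.
have gN : (\int[nu]_x (`|g x| `^ r)%:E <= M%:E)%E.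
  apply: (@integral_powR_le_content _ _ _ nu trunk g N r M) => //.
  - exact: sub_trunk.
  - exact: bigcup_trunk.
  move=> n A a mA An a0 Aa.
  (* With a nu(B) <= |Q(B)|, [QN] reads r a^r nu(B) <= (r-1) a^r nu(B) + N(B), and subtraction
     leaves the claim. *)
  have part B : measurable B -> B `<=` A ->
      (forall x, B x -> a <= g x) \/ (forall x, B x -> g x <= - a) ->
      a `^ r * fine (nu B) <= N B.
    move=> mB BA gB; have Bn : B `<=` trunk n by exact: subset_trans An.
    have [ig Qg] := gQ n.
    have : a * fine (nu B) <= `|Q B|.
      rewrite /Q Qg//; apply: le_normr_Rintegral_cst => //.
        by rewrite -ge0_fin_numE// (fin_num_nu mB Bn).
      exact: integrableS ig.
    have ra0 : 0 <= r * a `^ (r - 1) by rewrite mulr_ge0 ?powR_ge0// ltW.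
    move=> /(ler_wpM2l ra0)/le_trans/(_ (QN n B a mB Bn a0)).
    rewrite mulrA -[r * _ * a]mulrA powR_mul_sub1//.
    by lra.
  have mgge : measurable [set x | 0 <= g x].
    rewrite (_ : [set _ | _] = g @^-1` `[0, +oo[%classic).
      by rewrite -[_ @^-1` _]setTI; exact: mg.
    by apply/seteqP; split => x /=; rewrite in_itv/= andbT.
  pose B1 := A `&` [set x | 0 <= g x]; pose B2 := A `\` [set x | 0 <= g x].
  have mB1 : measurable B1 by exact: measurableI.
  have mB2 : measurable B2 by exact: measurableD.
  have B1n : B1 `<=` trunk n by move=> x [/An].
  have B2n : B2 `<=` trunk n by move=> x [/An].
  have B12 : B1 `&` B2 = set0 by rewrite -subset0 => x [[_ ?] []].
  have AB : A = B1 `|` B2 by rewrite setUIDK.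
  rewrite -(fineK (fin_num_nu mA An)) -EFinM lee_fin AB (NU n)//.
  rewrite (fine_nuU mB1 mB2 B1n B2n B12) mulrDr lerD//; apply: part => //.
  - by move=> x [].
  - by left=> x [/Aa ga /= g0]; rewrite -(ger0_norm g0).
  - by move=> x [].
  - right=> x [/Aa ga /= /negP]; rewrite -ltNge => g0.
    by rewrite lerNr -(ltr0_norm g0).
rewrite inE/=; apply/andP; split; rewrite inE//= /finite_norm unlock poweR_lty//.
by apply: le_lt_trans gN _; rewrite ltry.
Qed.

Lemma Tin_Hardy_Lfun_infty f : Tharmonic e nu par lev f ->
  Tin_Hardy e nu lev +oo%E f ->
  exists g : Omega -> R, g \in @Lfun _ Omega R nu +oo%E /\
    forall x, f x = Tpoisson e nu g x.
Proof.
move=> harm /= Hoo; set S := ereal_sup _ in Hoo.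
have Sle x : ((`|f x|)%:E <= S)%E by apply: ereal_sup_ubound; exists x.
have S0 : (0 <= S)%E by apply: le_trans (Sle o); rewrite lee_fin.
pose c := fine S.
have fc x : `|f x| <= c by rewrite -lee_fin fineK// ge0_fin_numE.
have c0 : 0 <= c by exact: fine_ge0.
have lsc n j A : measurable A -> A `<=` trunk n ->
    `|level_sum j f A| <= c * fine (nu A).
  move=> mA An; apply: le_trans (normr_level_sum _ _ An) _.
  rewrite -(level_sum_cst j c mA An).
  exact: level_sum_le An _.
have [L [LD _ Lle Lev]] := ultralimit R.
have fB n A : measurable A -> A `<=` trunk n ->
    exists B, forall j, `|level_sum j f A| <= B.
  by move=> mA An; exists (c * fine (nu A)) => j; exact: lsc An.
pose Q A := L (fun j => level_sum j f A).
have Qc n A : measurable A -> A `<=` trunk n -> `|Q A| <= c * fine (nu A).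
  move=> mA An; have <- : L (fun=> c * fine (nu A)) = c * fine (nu A).
    by apply: Lev; exact: nearW.
  apply: Lle => [||j]; [exact: fB An|by exists (`|c * fine (nu A)|)|exact: lsc An].
have [n eps eps0|g [mg gQ fg]] := Tharmonic_density LD Lev harm fB.
  exists c => A mA An; apply: le_trans (Qc n A mA An) _.
  by rewrite lerDr ltW.
exists g; split=> //.
(* The threshold c + 1 exceeds the bound c on the density of [Q]: (c+1) nu(B) <= c nu(B) forces
   nu(B) = 0. *)
have null B n : measurable B -> B `<=` trunk n ->
    (forall x, B x -> c + 1 <= g x) \/ (forall x, B x -> g x <= - (c + 1)) ->
    nu B = 0%E.
  move=> mB Bn gB; have [ig Qg] := gQ n.
  have : (c + 1) * fine (nu B) <= `|Q B|.
    rewrite /Q Qg//; apply: le_normr_Rintegral_cst => //.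
      by rewrite -ge0_fin_numE// (fin_num_nu mB Bn).
    exact: integrableS ig.
  move=> /le_trans/(_ (Qc n B mB Bn)); rewrite mulrDl mul1r gerDl => nuB.
  rewrite -(fineK (fin_num_nu mB Bn)); congr EFin; apply/eqP.
  by rewrite eq_le nuB fine_ge0.
have mge : measurable [set x | c + 1 <= g x].
  rewrite (_ : [set _ | _] = g @^-1` `[c + 1, +oo[%classic).
    by rewrite -[_ @^-1` _]setTI; exact: mg.
  by apply/seteqP; split => x /=; rewrite in_itv/= andbT.
have mle : measurable [set x | g x <= - (c + 1)].
  rewrite (_ : [set _ | _] = g @^-1` `]-oo, - (c + 1)]%classic).
    by rewrite -[_ @^-1` _]setTI; exact: mg.
  by apply/seteqP; split => x /=; rewrite in_itv.
(* The cut by trunks keeps each piece of finite measure, as [null] demands; countably many pieces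
   cover the points where |g| > c + 1. *)
have negl : nu.-negligible (\bigcup_n
    ((trunk n `&` [set x | c + 1 <= g x]) `|`
     (trunk n `&` [set x | g x <= - (c + 1)]))).
  apply: negligible_bigcup => n; apply: negligibleU.
    apply/negligibleP; first exact: measurableI.
    by apply: (null _ n); [exact: measurableI|exact: subIsetl|left=> x []].
  apply/negligibleP; first exact: measurableI.
  by apply: (null _ n); [exact: measurableI|exact: subIsetl|right=> x []].
rewrite inE/=; apply/andP; split; rewrite inE//= /finite_norm unlock.
case: ifPn => // _; apply: le_lt_trans (ltry (c + 1)).
apply/ess_supP; apply: negligibleS negl => x /= /negP.
rewrite lee_fin -ltNge => gx; have : [set: Omega] x by [].
rewrite -bigcup_trunk => -[n _ nx]; exists n => //.
have [g0|g0] := leP 0 (g x).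
  by left; split=> //=; move: gx; rewrite ger0_norm// => /ltW.
by right; split=> //=; move: gx; rewrite ltr0_norm// lerNr => /ltW.
Qed.

(** * From boundary functions to the Hardy space *)

(** Jensen bounds each term by the integral of [|g|^r] over its cylinder. Cylinders of one level are
    disjoint, so every finite partial sum is at most the integral over the whole boundary. *)
Lemma Lfun_Tin_Hardy_fin (r : R) (g : Omega -> R) : 1 < r ->
  g \in @Lfun _ Omega R nu r%:E -> Tin_Hardy e nu lev r%:E (Tpoisson e nu g).
Proof.
move=> r1 gL /=.
have mg : measurable_fun setT g by move: gL; rewrite inE => /andP[/[!inE]].
have mgr := measurable_powR_norm r mg.
have gr0 x : (0 <= (`|g x| `^ r)%:E)%E by rewrite lee_fin powR_ge0.
have /integrableP[_] := Lfun_integrable (ltW r1) gL.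
apply: le_lt_trans; apply: ge_ereal_sup => _ [k _ <-].
apply: ge_ereal_sup => _ [X [Xfin Xk] <-].
apply: le_trans (_ : _ <= \sum_(x \in X) \int[nu]_(w in cyl x) (`|g w| `^ r)%:E)%E _.
  apply: lee_fsum => // x _; apply: powR_mean_le => //.
  - by case: (nu_cyl x).
  - by case: (nu_cyl x).
  - exact: measurable_funTS.
rewrite fsbig_finite//= -ge0_integral_bigsetU//.
- apply: le_trans (_ : _ <= \int[nu]_w (`|g w| `^ r)%:E)%E _.
    by apply: ge0_subset_integral => //; exact: bigsetU_measurable.
  rewrite le_eqVlt; apply/orP; left; apply/eqP.
  by apply: eq_integral => w _; rewrite /= (ger0_norm (powR_ge0 _ _)).
- move=> x y /= xX yX [w [xw yw]].
  have inX z : z \in enum_fset (fset_set X) -> X z.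
    by rewrite -[_ \in _]/(z \in fset_set X) in_fset_set// inE.
  by apply: cyl_inj xw yw; rewrite (Xk _ (inX _ xX)) (Xk _ (inX _ yX)).
- exact: measurable_funTS.
Qed.

Lemma Lfun_Tin_Hardy_infty (g : Omega -> R) :
  g \in @Lfun _ Omega R nu +oo%E -> Tin_Hardy e nu lev +oo%E (Tpoisson e nu g).
Proof.
move=> gL /=.
have mg : measurable_fun setT g by move: gL; rewrite inE => /andP[/[!inE]].
(* Positive total mass selects the essential supremum in the norm of exponent infinity, whose
   default value is 0. *)
have nuT : (0 < nu setT)%E.
  by apply: lt_le_trans (nu_cyl o).1 _; rewrite le_measure// inE.
move: gL; rewrite inE => /andP[_]; rewrite inE /= /finite_norm unlock nuT.
move=> /(@ess_supr_bounded _ _ _ nu (Num.norm \o g))[M gM].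
apply: le_lt_trans (ltry `|M|); apply: ge_ereal_sup => _ [x _ <-].
have [x0 xoo] := nu_cyl x.
rewrite lee_fin /Tpoisson normrM gtr0_norm ?invr_gt0 ?m_gt0//.
rewrite ler_pdivrMl ?m_gt0//.
have bound : (`|\int[nu]_(w in cyl x) (g w)%:E| <= (m x * `|M|)%:E)%E.
  apply: le_trans (le_abse_integral _ _ _) _ => //.
    exact/measurable_EFinP/measurable_funTS.
  apply: le_trans (_ : _ <= \int[nu]_(w in cyl x) cst (`|M|)%:E w)%E _.
    apply: ae_ge0_le_integral => //.
    - by apply: measurableT_comp => //; exact/measurable_EFinP/measurable_funTS.
    - by move=> w _ /=; rewrite lee_fin.
    - apply: filterS gM => w gw _; rewrite /= lee_fin.
      exact: le_trans gw (ler_norm _).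
  by rewrite integral_cst// EFinM muleC fineK// ge0_fin_numE.
rewrite /Rintegral -lee_fin; apply: le_trans bound.
(* For an infinite integral [fine] returns 0, and the inequality still holds. *)
by case: (\int[nu]_(w in cyl x) _)%E => //=; rewrite normr0 leey.
Qed.

End TreeBoundary.

Theorem theorem2p2
  (V : choiceType) (par : V -> V) (lev : V -> int) (o : V)
  (d : measure_display) (Omega : measurableType d) (R : realType)
  (e : Omega -> (int -> V)) (nu : {measure set Omega -> \bar R})
  (p : \bar R) (f : V -> R) :
  Ttree_with_end par lev o ->
  Tlocally_finite par ->
  Tboundary_model e par lev ->
  (forall x, (0 < nu (Tbdry_cyl e x))%E /\ (nu (Tbdry_cyl e x) < +oo)%E) ->
  (1 < p)%E ->
  Tharmonic e nu par lev f ->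
  (exists g : Omega -> R, g \in @Lfun _ Omega R nu p /\ (forall x, f x = Tpoisson e nu g x))
  <-> Tin_Hardy e nu lev p f.
Proof.
move=> tree locfin bdry nu_cyl p1 harm; split.
  move=> [g [gL fg]]; have -> : f = Tpoisson e nu g by apply/funext.
  case: p p1 gL => [r||//].
    by rewrite lte_fin; exact: (Lfun_Tin_Hardy_fin bdry nu_cyl).
  by move=> _; exact: (Lfun_Tin_Hardy_infty o bdry nu_cyl).
case: p p1 => [r||//].
  by rewrite lte_fin => r1; exact: (Tin_Hardy_Lfun_fin tree locfin bdry nu_cyl).
by move=> _; exact: (Tin_Hardy_Lfun_infty tree locfin bdry nu_cyl).
Qed.
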